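(* Let $\Omega\subset\partial_\infty\mathbb H^2\times\mathbb R$ be a bounded $C^1$ domain, let $\epsilon\in[0,1]$ and $0<\alpha<1$, and let $g\in C^{2,\alpha}(\Omega)\cap C^1(\overline\Omega)$ be a positive solution in $\Omega$ of the $\epsilon$-horizontal minimal equation $$g_{xx}(g^2+g_t^2+\epsilon)+g_{tt}(1+g_x^2)-2g_xg_tg_{xt}+g(1+g_x^2)=0 .$$ Assume there exist constants $c_1,c_2,c_3$, independent of $\epsilon$, such that $0<c_1\le g\le c_2$ on $\overline\Omega$ and $|Dg|\le c_3$ on $\partial\Omega$. Assume further that $$c_2<c_1+c_1\sqrt{\frac{\pi}{2}} .$$ Then there exists a constant $C$ depending only on $c_1,c_2$ and $c_3$ such that $|Dg|\le C$ on the whole of $\overline\Omega$.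
   Context: Upper half-plane model: $\mathbb H^2=\{(x,y): y>0\}$, and $\partial_\infty\mathbb H^2\times\mathbb R$ is identified with $\mathbb R\times\mathbb R=\mathbb R^2$ with coordinates $(x,t)$ and the Euclidean metric. $Dg=(g_x,g_t)$. *)

(* Defs.v *)
From mathcomp Require Export all_boot all_order all_algebra.
From mathcomp Require Export all_classical all_reals all_analysis.
Export Order.TTheory GRing.Theory Num.Theory.
Export numFieldNormedType.Exports.

Set Implicit Arguments.
Unset Strict Implicit.
Unset Printing Implicit Defensive.

Local Open Scope classical_set_scope.
Local Open Scope ring_scope.

(* The plane is R * R, a point being p = (x, t). The norm that MathComp-Analysis
   puts on R * R is the sup norm: it is used only through the topology and the
   notion of bounded set; metric statements use the Euclidean norm below. *)

Definition enorm (R : realType) (v : R * R) : R :=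
  Num.sqrt (v.1 ^+ 2 + v.2 ^+ 2).

Definition Dx (R : realType) (f : R * R -> R) (p : R * R) : R :=
  'D_((1, 0) : R * R) f p.

Definition Dt (R : realType) (f : R * R -> R) (p : R * R) : R :=
  'D_((0, 1) : R * R) f p.

(* 'D_v is total (with a junk value when the limit does not exist), hence the
   explicit derivability requirements. *)
Definition C1_in (R : realType) (Omega : set (R * R)) (f : R * R -> R) : Prop :=
  forall p, Omega p ->
    [/\ derivable f p ((1, 0) : R * R), derivable f p ((0, 1) : R * R),
        {for p, continuous f}, {for p, continuous (Dx f)}
      & {for p, continuous (Dt f)}].

Definition C2_in (R : realType) (Omega : set (R * R)) (f : R * R -> R) : Prop :=
  [/\ C1_in Omega f, C1_in Omega (Dx f) & C1_in Omega (Dt f)].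

Definition locally_holder (R : realType) (alpha : R) (Omega : set (R * R))
    (f : R * R -> R) : Prop :=
  forall K : set (R * R), compact K -> K `<=` Omega ->
    exists H : R, forall p q : R * R, K p -> K q ->
      `|f p - f q| <= H * enorm (p - q) `^ alpha.

(* C^{2,alpha}(Omega), as opposed to C^{2,alpha} of the closure: the Hoelder
   condition is only required on compact subsets of Omega. *)
Definition C2alpha_in (R : realType) (alpha : R) (Omega : set (R * R))
    (f : R * R -> R) : Prop :=
  C2_in Omega f /\
  [/\ locally_holder alpha Omega (Dx (Dx f)),
      locally_holder alpha Omega (Dt (Dx f)),
      locally_holder alpha Omega (Dx (Dt f))
    & locally_holder alpha Omega (Dt (Dt f))].

Definition extends_continuously (R : realType) (Omega : set (R * R))
    (f : R * R -> R) : Prop :=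
  exists F : R * R -> R,
    {within closure Omega, continuous F} /\ {in Omega, F =1 f}.

(* The value at p of the continuous extension of f from Omega to its closure
   (see closure_extE). *)
Definition closure_ext (R : realType) (Omega : set (R * R))
    (f : R * R -> R) (p : R * R) : R :=
  lim (f q @[q --> within Omega (nbhs p)]).

Lemma closure_extE (R : realType) (Omega : set (R * R)) (f F : R * R -> R) :
  {within closure Omega, continuous F} -> {in Omega, F =1 f} ->
  forall p, closure Omega p -> closure_ext Omega f p = F p.
Proof.
move=> /subspace_continuousP cF Ff p clp.
have PF : ProperFilter (within Omega (nbhs p)).
  apply: within_nbhs_proper; exact: clp.
apply: cvg_lim; first exact: Rhausdorff.
move=> A /(cF p clp); rewrite /= /nbhs /= /within /= => FA.
apply: filterS FA => q FA Oq; rewrite /preimage /= -Ff ?inE//.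
by apply: FA; exact: subset_closure.
Qed.

(* C^1 up to the boundary: the function is continuous on the closure, and its
   first derivatives in Omega extend continuously to the closure. *)
Definition C1_closure (R : realType) (Omega : set (R * R)) (g : R * R -> R)
    : Prop :=
  [/\ {within closure Omega, continuous g}, C1_in Omega g,
      extends_continuously Omega (Dx g) & extends_continuously Omega (Dt g)].

(* Dg = (g_x, g_t) on the closure of Omega; on the boundary this is the
   continuous extension of the gradient in Omega. *)
Definition grad (R : realType) (Omega : set (R * R)) (g : R * R -> R)
    (p : R * R) : R * R :=
  (closure_ext Omega (Dx g) p, closure_ext Omega (Dt g) p).

Definition boundary (T : topologicalType) (A : set T) : set T :=
  closure A `\` A°.

(* Near p0, in the orthonormal coordinates
     s = b (x - x0) - a (t - t0),   h = a (x - x0) + b (t - t0),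
   Omega is the strict epigraph h > gamma s of a C^1 function gamma. *)
Definition C1_boundary_at (R : realType) (Omega : set (R * R)) (p0 : R * R)
    : Prop :=
  exists (a b r : R) (gamma : R -> R),
    [/\ a ^+ 2 + b ^+ 2 = 1, 0 < r, (forall s, derivable gamma s 1),
        continuous (derive1 gamma)
      & forall p : R * R, enorm (p - p0) < r ->
          (Omega p <->
           gamma (b * (p.1 - p0.1) - a * (p.2 - p0.2))
             < a * (p.1 - p0.1) + b * (p.2 - p0.2))].

Definition bounded_C1_domain (R : realType) (Omega : set (R * R)) : Prop :=
  [/\ open Omega, connected Omega, Omega !=set0, bounded_set Omega
    & forall p, boundary Omega p -> C1_boundary_at Omega p].

Definition eps_horizontal_minimal (R : realType) (eps : R)
    (Omega : set (R * R)) (g : R * R -> R) : Prop :=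
  forall p, Omega p ->
    Dx (Dx g) p * (g p ^+ 2 + Dt g p ^+ 2 + eps)
    + Dt (Dt g) p * (1 + Dx g p ^+ 2)
    - 2 * Dx g p * Dt g p * Dt (Dx g) p
    + g p * (1 + Dx g p ^+ 2) = 0.

(* Main.v *)
(** In terms of u = g^3/3 the equation reads A(g, Du) : D^2 u = B(g, Du) with
   A positive definite. Suppose |Du| attains its maximum over the closure of
   Omega at an interior point p0 and let e = Du(p0), N = |e|^2. For small d > 0
   maximise u(p + d e) - u(p) over the compact set where the derivative of u
   along e is close to N. At an interior maximum Du takes the same value at both
   points and D^2 u(p + d e) <= D^2 u(p); subtracting the two equations and
   dividing by g(p + d e) - g(p) > 0 gives an inequality T(p, d) <= 0. The
   maximum points accumulate, as d -> 0, at points where Du = e, and there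
   T(p, 0) >= c N - C, with c > 0 and C depending only on c1 and c2, because
   D^2 u e = 0 and the equation bounds the remaining eigenvalue of D^2 u from
   above. Hence N is bounded unless the maximum lies on the boundary. Comparing
   two nearby points replaces differentiating the equation, for which g would
   need third derivatives. *)
Require Import Defs.
From mathcomp Require Import ring lra.

Set Implicit Arguments.
Unset Strict Implicit.
Unset Printing Implicit Defensive.

Local Open Scope classical_set_scope.
Local Open Scope ring_scope.

(** * Mean value theorem along lines and directional derivatives of C^1 functions *)

Section Calculus.
Variable R : realType.

Lemma is_derive_line (V : normedModType R) (f : V -> R) (p v : V) (h s df : R) :
  is_derive (p + (s * h) *: v) v f df ->
  is_derive s 1 (fun s => f (p + (s * h) *: v)) (h * df).
Proof.
move=> [/derivable1P fd <-].
set p' := p + (s * h) *: v in fd *.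
pose phi := (fun r : R => f (r *: v + p')).
(* The point 0 is written [s * h - s * h], the value at [s] of the affine map in [lin], so that the
   one-variable chain rule applies as it stands. *)
have phiD : is_derive (s * h - s * h) 1 phi ('D_v f p').
  rewrite subrr; suff -> : 'D_v f p' = 'D_1 phi 0 by exact/derivableP.
  rewrite /derive; set F := fun _ => _; set G := fun _ => _.
  suff -> : F = G by []; apply/funext => r; rewrite /F /G /=.
  by rewrite /phi addr0 scale0r add0r [_%:A]mulr1.
have lin : is_derive s 1 (fun r : R => r * h - s * h) h.
  have -> : (fun r : R => r * h - s * h) = (h *: id) - cst (s * h).
    by apply/funext => r; rewrite !fctE /= [h *: r]mulrC.
  by apply: is_derive_eq; rewrite subr0 [LHS]mulr1.
have -> : (fun s => f (p + (s * h) *: v)) = phi \o (fun r => r * h - s * h).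
  apply/funext => r; rewrite /phi /p' /= scalerBl.
  by congr f; rewrite addrCA subrK.
exact: (is_derive_eq (is_derive1_comp (g := fun r => r * h - s * h) phiD lin)
  (mulrC _ _)).
Qed.

Lemma MVT_line (V : normedModType R) (f : V -> R) (p v : V) (h : R) :
  (forall s : R, 0 <= s <= 1 -> derivable f (p + (s * h) *: v) v) ->
  exists2 s : R, 0 < s < 1 &
    f (p + h *: v) - f p = h * 'D_v f (p + (s * h) *: v).
Proof.
move=> df.
have dphi (s : R) : 0 <= s <= 1 -> is_derive s (1 : R)
    (fun s => f (p + (s * h) *: v)) (h * 'D_v f (p + (s * h) *: v)).
  by move=> s01; apply: is_derive_line; apply: DeriveDef => //; exact: df.
have [|||s s01] := @MVT R (fun s => f (p + (s * h) *: v))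
  (fun s => h * 'D_v f (p + (s * h) *: v)) 0 1.
- exact: ltr01.
- by move=> s; rewrite in_itv/= => /andP[s0 s1]; apply: dphi; rewrite !ltW.
- by apply: derivable_within_continuous => s; rewrite in_itv/= => /dphi [].
by rewrite !mul1r mul0r scale0r addr0 subr0 mulr1 => E; exists s.
Qed.

(** Move first horizontally and then vertically, with one mean value theorem for each leg. Balls of
    [R * R] are squares, so both legs and the corner stay in the ball. *)
Lemma C1_increment (Omega : set (R * R)) (f : R * R -> R) (p q : R * R) (r : R) :
  C1_in Omega f -> ball p r `<=` Omega -> ball p r q ->
  exists2 xi, ball p r xi & exists2 eta, ball p r eta &
    f q - f p = (q.1 - p.1) * Dx f xi + (q.2 - p.2) * Dt f eta.
Proof.
case: p q => p1 p2 [q1 q2] fC1 pr [/= q1p q2p].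
have btw (a b s : R) : ball a r b -> 0 <= s <= 1 -> ball a r (a + s * (b - a)).
  rewrite /ball /= => ab /andP[s0 s1].
  rewrite opprD addNKr normrN normrM (ger0_norm s0) distrC.
  by apply: le_lt_trans ab; rewrite ler_piMl.
have oW (s : R) : 0 < s < 1 -> 0 <= s <= 1.
  by move=> /andP[s0 s1]; rewrite !ltW.
have r0 : 0 < r by move: q1p; rewrite /ball/=; exact: le_lt_trans.
have [|s /oW s01] := @MVT_line _ f (p1, p2) (1, 0) (q1 - p1).
  move=> s s01.
  suff /fC1[dx _ _ _ _] : Omega ((p1, p2) + (s * (q1 - p1)) *: (1, 0)).
    exact: dx.
  by apply: pr; split => /=; rewrite ?scaler0 ?addr0 ?[_%:A]mulr1;
    [exact: btw | exact: ballxx].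
have [|t /oW t01] := @MVT_line _ f (q1, p2) (0, 1) (q2 - p2).
  move=> t t01.
  suff /fC1[_ dt _ _ _] : Omega ((q1, p2) + (t * (q2 - p2)) *: (0, 1)).
    exact: dt.
  by apply: pr; split => /=; rewrite ?scaler0 ?addr0 ?[_%:A]mulr1;
    [exact: q1p| exact: btw].
have -> : (p1, p2) + (q1 - p1) *: (1, 0) = (q1, p2).
  by congr pair; rewrite /= ?scaler0 ?addr0 // [_%:A]mulr1 addrC subrK.
have -> : (q1, p2) + (q2 - p2) *: (0, 1) = (q1, q2).
  by congr pair; rewrite /= ?scaler0 ?addr0 // [_%:A]mulr1 addrC subrK.
move=> E2 E1; eexists; last eexists; last first.
- rewrite -[LHS](subrKA (f (q1, p2))) addrC E1 E2; reflexivity.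
- by split => /=; rewrite ?scaler0 ?addr0 ?[_%:A]mulr1;
    [exact: q1p| exact: btw].
- by split => /=; rewrite ?scaler0 ?addr0 ?[_%:A]mulr1;
    [exact: btw | exact: ballxx].
Qed.

(** By [C1_increment] the difference quotient is [v.1 * Dx f xi + v.2 * Dt f eta] with both points
    tending to [p]; continuity of the partial derivatives gives the limit. *)
Lemma C1_is_derive (Omega : set (R * R)) (f : R * R -> R) (p v : R * R) :
  open Omega -> C1_in Omega f -> Omega p ->
  is_derive p v f (v.1 * Dx f p + v.2 * Dt f p).
Proof.
move=> oO fC1 Op.
suff L : (fun h => h^-1 *: (f (h *: v + p) - f p)) @ 0^' -->
    v.1 * Dx f p + v.2 * Dt f p.
  apply: DeriveDef; last exact: cvg_lim L.
  by apply/cvg_ex; exists (v.1 * Dx f p + v.2 * Dt f p).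
have [_ _ _ cx ct] := fC1 p Op.
(* Allowing each partial derivative an error [e / k] gives a total error at most [e]; the summand 1
   keeps [k] positive when [v = 0]. *)
pose k := `|v.1| + `|v.2| + 1.
have k0 : 0 < k by rewrite ltr_pwDr// addr_ge0.
apply/cvgrPdist_le => e e0.
have ek0 : 0 < e / k by rewrite divr_gt0.
have /nbhs_ballP[r r0 rP] : \forall q \near p,
    [/\ Omega q, `|Dx f p - Dx f q| <= e / k & `|Dt f p - Dt f q| <= e / k].
  move/cvgrPdist_le : cx => /(_ _ ek0) cx.
  move/cvgrPdist_le : ct => /(_ _ ek0) ct.
  have OO : \forall q \near p, Omega q by exact: open_nbhs_nbhs.
  apply: filterS3 OO cx ct => q Oq H1 H2; split; [exact: Oq|exact: H1|exact: H2].
have hv : \forall h \near 0^', ball p r (h *: v + p).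
  apply: nbhs_dnbhs.
  have : (fun h : R => h *: v + p) @ nbhs (0:R) --> 0 *: v + p.
    apply: cvgD; last exact: cvg_cst.
    by apply: cvgZ; [exact: cvg_id | exact: cvg_cst].
  rewrite scale0r add0r.
  by apply; apply: nbhsx_ballx.
near=> h.
have h0 : h != 0 by near: h; exact: nbhs_dnbhs_neq.
have hb : ball p r (h *: v + p) by near: h.
have [|xi /rP[_ xiP _] [eta /rP[_ _ etaP] ->]] := C1_increment fC1 _ hb.
  by move=> q /rP[].
rewrite /= !addrK /GRing.scale /=.
have -> : h^-1 * (h * v.1 * Dx f xi + h * v.2 * Dt f eta) =
  v.1 * Dx f xi + v.2 * Dt f eta by field.
rewrite opprD addrACA -!mulrBr.
apply: le_trans (ler_normD _ _) _; rewrite !normrM.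
apply: (@le_trans _ _ (k * (e / k))); last by rewrite mulrC divfK// gt_eqF.
rewrite {1}/k mulrDl mulrDl mul1r ler_wpDr ?(ltW ek0)//.
by rewrite lerD// ler_wpM2l.
Unshelve. all: by end_near. Qed.

End Calculus.

(** * Conditions at a local maximum along a direction, and mixed second differences *)

Section Directional.
Variables (R : realType) (V : normedModType R).
Implicit Types (f : V -> R) (p v w a b : V).

Lemma cvg_line p v : (fun s : R => p + s *: v) @ (0 : R) --> p.
Proof.
have : (fun s : R => p + s *: v) @ (0 : R) --> p + 0 *: v.
  apply: cvgD; first exact: cvg_cst.
  by apply: cvgZ; [exact: cvg_id | exact: cvg_cst].
by rewrite scale0r addr0.
Qed.

Lemma is_derive_translate f p a v df :
  is_derive (p + a) v f df -> is_derive p v (fun q => f (q + a)) df.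
Proof.
have E : (fun h : R => h^-1 *: (f (h *: v + (p + a)) - f (p + a))) =
    (fun h : R => h^-1 *: (f (h *: v + p + a) - f (p + a))).
  by apply/funext => h; rewrite addrA.
by move=> [fd <-]; split; rewrite /derivable /derive /= -E.
Qed.

(** The mean value theorem on a short segment issuing from [p] would produce a value above [f p].
    The first- and second-order conditions below both reduce to this. *)
Lemma no_increase_at_max f p w :
  (\forall q \near p, derivable f q w) -> (\forall q \near p, f q <= f p) ->
  ~ (\forall s \near (0 : R), 0 < s -> 0 < 'D_w f (p + s *: w)).
Proof.
move=> fd fmax.
have : nbhs (0 : R) [set s | derivable f (p + s *: w) w /\ f (p + s *: w) <= f p].
  have H : nbhs p [set q | derivable f q w /\ f q <= f p] by exact: filterI.
  exact: (@cvg_line p w _ H).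
move=> /nbhs_ballP[r /= r0 rP].
move=> /nbhs_ballP[t /= t0 tP].
pose h := Num.min r t / 2.
have m0 : 0 < Num.min r t by rewrite lt_min r0 t0.
have h0 : 0 < h by rewrite /h; lra.
have [hr ht] : h < r /\ h < t.
  by apply/andP; rewrite -lt_min /h; lra.
have ball0 (s k : R) : 0 <= s <= 1 -> h < k -> ball (0 : R) k (s * h).
  move=> /andP[s0 s1] hk; rewrite /ball /= sub0r normrN ger0_norm.
    by apply: le_lt_trans hk; rewrite ler_piMl// ltW.
  by rewrite mulr_ge0// ltW.
have [s s01|s /andP[s0 s1]] := @MVT_line R V f p w h.
  by have [] := rP _ (ball0 s r s01 hr).
have i1 : 0 <= (1 : R) <= 1 by rewrite ler01 lexx.
have [_] := rP _ (ball0 1 r i1 hr); rewrite mul1r => fh.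
have : 0 < 'D_w f (p + (s * h) *: w).
  by apply: tP; [apply: ball0 => //; rewrite !ltW|rewrite mulr_gt0].
move=> D0 E; have : 0 < f (p + h *: w) - f p by rewrite E mulr_gt0.
by rewrite subr_gt0 ltNge fh.
Qed.

Lemma derive_max_le0 f p w :
  (\forall q \near p, derivable f q w) -> {for p, continuous ('D_w f)} ->
  (\forall q \near p, f q <= f p) -> 'D_w f p <= 0.
Proof.
move=> fd cf fmax; rewrite leNgt; apply/negP => D0.
apply: (no_increase_at_max fd fmax).
have H : nbhs p [set q | 0 < 'D_w f q] by exact: (cvgr_gt _ cf).
have H' : \forall s \near (0 : R), 0 < 'D_w f (p + s *: w).
  exact: (@cvg_line p w _ H).
by apply: filterS H' => s.
Qed.

(** Were the second derivative positive, the difference quotient of ['D_w f] at [p] would already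
    make ['D_w f] positive just beyond [p]; no continuity of the second derivative enters. *)
Lemma derive2_max_le0 f p w :
  (\forall q \near p, derivable f q w) -> derivable ('D_w f) p w ->
  'D_w f p = 0 ->
  (\forall q \near p, f q <= f p) -> 'D_w ('D_w f) p <= 0.
Proof.
move=> fd dDf Df0 fmax; rewrite leNgt; apply/negP => D0.
apply: (no_increase_at_max fd fmax).
have /= : \forall h \near 0^', 0 < h^-1 *: ('D_w f (h *: w + p) - 'D_w f p).
  exact: (cvgr_gt _ dDf).
rewrite near_withinE; apply: filterS => h hP h0; rewrite addrC.
have := hP (lt0r_neq0 h0); rewrite Df0 subr0.
by rewrite pmulr_rgt0// invr_gt0.
Qed.

(** The mean value theorem is applied along [a] to the increment of [f] by [h *: b], then along [b]
    to ['D_a f]. *)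
Lemma mixed_increment f p a b (h : R) :
  (forall s t : R, 0 <= s <= 1 -> 0 <= t <= 1 ->
    derivable f (p + (s * h) *: a + (t * h) *: b) a /\
    derivable ('D_a f) (p + (s * h) *: a + (t * h) *: b) b) ->
  exists s t : R, [/\ 0 < s < 1, 0 < t < 1 &
    f (p + h *: a + h *: b) - f (p + h *: a) - (f (p + h *: b) - f p) =
    h * (h * 'D_b ('D_a f) (p + (s * h) *: a + (t * h) *: b))].
Proof.
move=> dP.
pose F q := f (q + h *: b) - f q.
have i0 : 0 <= (0 : R) <= 1 by rewrite lexx ler01.
have i1 : 0 <= (1 : R) <= 1 by rewrite lexx ler01.
have dF (s : R) : 0 <= s <= 1 -> is_derive (p + (s * h) *: a) a F
   ('D_a f (p + (s * h) *: a + h *: b) - 'D_a f (p + (s * h) *: a)).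
  move=> s01; apply: is_deriveB; last first.
    by have [] := dP s 0 s01 i0; rewrite mul0r scale0r addr0 => /derivableP.
  apply: is_derive_translate.
  by have [] := dP s 1 s01 i1; rewrite mul1r => /derivableP.
have [s s01|s s01] := @MVT_line R V F p a h; first by have [] := dF s s01.
have s01' : 0 <= s <= 1 by move: s01 => /andP[s0 s1]; rewrite !ltW.
have [_ ->] := dF s s01'.
have [t t01|t t01 ->] := @MVT_line R V ('D_a f) (p + (s * h) *: a) b h.
  by have [] := dP s t s01' t01.
by rewrite /F => E; exists s, t; split => //; rewrite -E addrAC.
Qed.

End Directional.

(** * Symmetry of the second derivatives *)

Section Plane.
Variable R : realType.
Implicit Types (Omega : set (R * R)) (f u : R * R -> R) (p q v w : R * R).

(** The second difference over a small square is symmetric in the two directions. By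
    [mixed_increment] the two mixed derivatives therefore agree at a pair of points close to [p],
    and continuity carries this to [p]. *)
Lemma C2_symmetric Omega f p : open Omega -> C2_in Omega f -> Omega p ->
  Dt (Dx f) p = Dx (Dt f) p.
Proof.
move=> oO [f1 f2 f3] Op.
have [_ _ _ _ cxt] := f2 p Op; have [_ _ _ ctx _] := f3 p Op.
apply/eqP; rewrite eq_sym -subr_eq0 -normr_le0; apply/ler_addgt0Pl => e e0.
rewrite addr0.
have e2 : 0 < e / 2 by lra.
have OO : \forall q \near p, Omega q by exact: open_nbhs_nbhs.
move/cvgrPdist_le : ctx => /(_ _ e2) ctx.
move/cvgrPdist_le : cxt => /(_ _ e2) cxt.
have /nbhs_ballP[r /= r0 rP] : \forall q \near p, [/\ Omega q,
    `|Dx (Dt f) p - Dx (Dt f) q| <= e / 2 &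
    `|Dt (Dx f) p - Dt (Dx f) q| <= e / 2].
  apply: filterS3 OO ctx cxt => q Oq H1 H2; split; [exact: Oq|exact: H1|exact: H2].
pose h := r / 2; have h0 : 0 < h by rewrite divr_gt0.
have hr : h < r by rewrite /h; lra.
pose a : R * R := (1, 0); pose b : R * R := (0, 1).
have inb (s t : R) : 0 <= s <= 1 -> 0 <= t <= 1 ->
    ball p r (p + (s * h) *: a + (t * h) *: b).
  have aux (x z : R) : 0 <= z <= 1 -> ball x r (x + z * h).
    move=> /andP[z0 z1]; rewrite /ball /= opprD addNKr normrN ger0_norm.
      by apply: le_lt_trans hr; rewrite ler_piMl// ltW.
    by rewrite mulr_ge0// ltW.
  move=> s01 t01; split; rewrite /= scaler0 addr0 [_%:A]mulr1; exact: aux.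
have oW (s : R) : 0 < s < 1 -> 0 <= s <= 1.
  by move=> /andP[s0 s1]; rewrite !ltW.
have [s t s01 t01|s [t [/oW s01 /oW t01]]] := @mixed_increment R _ f p a b h.
  have [/[dup]/f1[da _ _ _ _]/f2[_ dab _ _ _] _ _] := rP _ (inb s t s01 t01).
  by split; [exact: da|exact: dab].
have E (s' t' : R) : p + (s' * h) *: b + (t' * h) *: a =
    p + (t' * h) *: a + (s' * h) *: b by rewrite addrAC.
have [s' t' s'01 t'01|s' [t' [/oW s'01 /oW t'01]]] :=
    @mixed_increment R _ f p b a h.
  rewrite E.
  have [/[dup]/f1[_ da _ _ _]/f3[dab _ _ _ _] _ _] := rP _ (inb t' s' t'01 s'01).
  by split; [exact: da|exact: dab].
rewrite E [p + h *: b + _]addrAC.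
have -> : f (p + h *: a + h *: b) - f (p + h *: b) - (f (p + h *: a) - f p) =
  f (p + h *: a + h *: b) - f (p + h *: a) - (f (p + h *: b) - f p) by ring.
move=> ->.
have [_ + _] := rP _ (inb t' s' t'01 s'01).
have [_ _] := rP _ (inb s t s01 t01).
move: (_ + (s' * h) *: b) (_ + (t * h) *: b) => xi eta H2 H1 E3.
have {}E3 : Dx (Dt f) xi = Dt (Dx f) eta.
  apply: (mulfI (lt0r_neq0 h0)); apply: (mulfI (lt0r_neq0 h0)).
  exact: E3.
rewrite E3 in H1.
apply: le_trans (ler_distD (Dt (Dx f) eta) _ _) _.
rewrite [e]splitr; apply: lerD; [exact: H1|rewrite distrC; exact: H2].
Qed.

End Plane.

(** * Comparison of gradients and Hessians at two points *)

Section TwoPoint.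
Variable R : realType.
Implicit Types (Omega : set (R * R)) (f u : R * R -> R) (p q v w : R * R).

Lemma near_eq_continuous (T U : topologicalType) (f g : T -> U) (p : T) :
  (\forall q \near p, f q = g q) -> {for p, continuous f} ->
  {for p, continuous g}.
Proof.
move=> fg cf; rewrite /prop_for /continuous_at -(nbhs_singleton fg).
by apply: cvg_trans cf; exact: near_eq_cvg.
Qed.

(* The mixed term uses the symmetry of the second derivatives (C2_symmetric). *)
Definition hess u p w : R :=
  w.1 ^+ 2 * Dx (Dx u) p + 2 * w.1 * w.2 * Dt (Dx u) p + w.2 ^+ 2 * Dt (Dt u) p.

Lemma C1_near_derive Omega f p w : open Omega -> C1_in Omega f -> Omega p ->
  \forall q \near p, 'D_w f q = w.1 * Dx f q + w.2 * Dt f q.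
Proof.
move=> oO f1 Op.
have OO : \forall q \near p, Omega q by exact: open_nbhs_nbhs.
by apply: filterS OO => q Oq; have [_ ->] := C1_is_derive w oO f1 Oq.
Qed.

Lemma C1_derive_continuous Omega f p w : open Omega -> C1_in Omega f ->
  Omega p -> {for p, continuous ('D_w f)}.
Proof.
move=> oO f1 Op; have [_ _ _ cx ct] := f1 p Op.
apply: (@near_eq_continuous _ _ (fun q => w.1 * Dx f q + w.2 * Dt f q)).
  by apply: filterS (C1_near_derive w oO f1 Op) => q ->.
by apply: cvgD; (apply: cvgM; [exact: cvg_cst|]); [exact: cx|exact: ct].
Qed.

Lemma C2_is_derive2 Omega f p w : open Omega -> C2_in Omega f -> Omega p ->
  is_derive p w ('D_w f) (hess f p w).
Proof.
move=> oO /[dup] f2 [f1 fx ft] Op.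
apply: (@near_eq_is_derive _ _ _ (w.1 \*: Dx f + w.2 \*: Dt f)).
  by apply: filterS (C1_near_derive w oO f1 Op) => q ->.
have dx := C1_is_derive w oO fx Op; have dt := C1_is_derive w oO ft Op.
apply: is_derive_eq; rewrite -(C2_symmetric oO f2 Op) /hess /GRing.scale /=.
move: (Dx (Dx f) p) (Dt (Dx f) p) (Dt (Dt f) p) w.1 w.2 => x y z a b.
ring.
Qed.

(** These are the first- and second-order conditions for the increment [F q = u (q + a) - u q] at
    its local maximum [p]. Only second derivatives of [u] enter. *)
Lemma two_point_max Omega u p a :
  open Omega -> C2_in Omega u -> Omega p -> Omega (p + a) ->
  (\forall q \near p, u (q + a) - u q <= u (p + a) - u p) ->
  [/\ Dx u (p + a) = Dx u p, Dt u (p + a) = Dt u p &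
      forall w, hess u (p + a) w <= hess u p w].
Proof.
move=> oO u2 Op Opa umax; have [u1 _ _] := u2.
pose F q := u (q + a) - u q.
have tr : (fun q => q + a) @ p --> p + a.
  by apply: cvgD; [exact: cvg_id|exact: cvg_cst].
have OO : \forall q \near p, Omega q by exact: open_nbhs_nbhs.
have OOa : \forall q \near p, Omega (q + a).
  have H : nbhs (p + a) Omega by exact: open_nbhs_nbhs.
  exact: (tr _ H).
have dF q w : Omega q -> Omega (q + a) ->
    is_derive q w F ('D_w u (q + a) - 'D_w u q).
  move=> Oq Oqa; apply: is_deriveB.
    apply: is_derive_translate; apply: derivableP.
    by have [] := C1_is_derive w oO u1 Oqa.
  by apply: derivableP; have [] := C1_is_derive w oO u1 Oq.
have dFn w : \forall q \near p, derivable F q w.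
  by apply: filterS2 OO OOa => q Oq Oqa; have [] := dF q w Oq Oqa.
have DFn w : \forall q \near p, 'D_w u (q + a) - 'D_w u q = 'D_w F q.
  by apply: filterS2 OO OOa => q Oq Oqa; have [_ ->] := dF q w Oq Oqa.
have D1le w : 'D_w u (p + a) <= 'D_w u p.
  rewrite -subr_le0 (nbhs_singleton (DFn w)).
  apply: derive_max_le0; [exact: dFn| |exact: umax].
  apply: near_eq_continuous (DFn w) _.
  apply: cvgB; last exact: C1_derive_continuous Op.
  have c : {for p + a, continuous ('D_w u)} by exact: C1_derive_continuous Opa.
  exact: (@cvg_comp _ _ _ (fun q => q + a) ('D_w u) _ _ _ tr c).
have DN q w : Omega q -> 'D_(- w) u q = - 'D_w u q.
  move=> Oq; have [_ ->] := C1_is_derive (- w) oO u1 Oq.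
  by have [_ ->] := C1_is_derive w oO u1 Oq; rewrite /=; ring.
(* The inequality [D1le] for the direction [- w] is the reverse inequality for [w]. *)
have D1 w : 'D_w u (p + a) = 'D_w u p.
  apply/eqP; rewrite eq_le D1le /=.
  by have := D1le (- w); rewrite !DN// lerN2.
split; [exact: D1|exact: D1|move=> w].
have [d2 E2] : is_derive p w ('D_w F) (hess u (p + a) w - hess u p w).
  apply: near_eq_is_derive (DFn w) _.
  apply: (@is_deriveB _ _ _ (fun q => 'D_w u (q + a)) ('D_w u)).
    apply: (@is_derive_translate _ _ ('D_w u)); exact: C2_is_derive2 Opa.
  exact: C2_is_derive2 Op.
rewrite -subr_le0 -E2; apply: derive2_max_le0.
- exact: dFn.
- exact: d2.
- by rewrite -(nbhs_singleton (DFn w)) D1 subrr.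
- exact: umax.
Qed.

End TwoPoint.

(** * Pointwise algebra of the equation and of its difference quotient in [g] *)

Section Algebra.
Variable R : realType.
Implicit Types (a b g e x y z : R) (n : nat).

(** The divided difference of the n-th power between [a] and [b], as a polynomial: it still makes
    sense at [a = b], where the limit of the two-point comparison is taken. *)
Definition dpow n a b : R := \sum_(i < n) a ^+ (n.-1 - i) * b ^+ i.

Lemma dpowE n a b : a ^+ n - b ^+ n = (a - b) * dpow n a b.
Proof. exact: subrXX. Qed.

Lemma dpow_diag n a : dpow n a a = n%:R * a ^+ n.-1.
Proof.
rewrite /dpow (eq_bigr (fun=> a ^+ n.-1)).
  by rewrite sumr_const card_ord mulr_natl.
by case: n => [[]//|n] i _; rewrite -exprD subnK// -ltnS.
Qed.

(* The equation for g reads trace (A D^2 u) = rhs in terms of u = g^3 / 3. *)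
Definition rhs g e q1 q2 : R :=
  g ^+ 3 * q1 ^+ 2 + 2 * g * (e * q1 ^+ 2 + q2 ^+ 2) - g ^+ 7.

(** Here [(q1, q2)] stands for Du and [x], [y], [z] for u_xx, u_xt, u_tt. The matrix A is diag(g^6 +
    e g^4, g^4) plus the rank-one matrix of the vector (q2, -q1), which is orthogonal to Du and does
    not involve [g]. *)
Definition eqn g e q1 q2 x y z : Prop :=
  (g ^+ 6 + e * g ^+ 4) * x + g ^+ 4 * z
  + (q2 ^+ 2 * x - 2 * q1 * q2 * y + q1 ^+ 2 * z) = rhs g e q1 q2.

(* The difference quotient, between g = b and g = a, of rhs minus the left-hand
   side of eqn, with Du and D^2 u kept fixed. *)
Definition quot a b e q1 q2 x z : R :=
  q1 ^+ 2 * dpow 3 a b + 2 * (e * q1 ^+ 2 + q2 ^+ 2) - dpow 7 a b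
  - (dpow 6 a b + e * dpow 4 a b) * x - dpow 4 a b * z.

(** Replacing the Hessian at [a] by the larger one at [b] can only increase trace (A D^2 u), because
    A is positive. Subtracting the equation at [b] leaves [(a - b) * quot]. The rank-one part, and
    with it [y], cancels since it does not depend on [g]. *)
Lemma quot_le0 a b e q1 q2 x y z x1 y1 z1 : 0 < b -> b < a -> 0 <= e ->
  eqn a e q1 q2 x1 y1 z1 -> eqn b e q1 q2 x y z ->
  (forall w1 w2 : R, w1 ^+ 2 * x1 + 2 * w1 * w2 * y1 + w2 ^+ 2 * z1 <=
                w1 ^+ 2 * x + 2 * w1 * w2 * y + w2 ^+ 2 * z) ->
  quot a b e q1 q2 x z <= 0.
Proof.
move=> b0 ba e0 Ea Eb H; have a0 := lt_trans b0 ba.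
have ab0 : 0 < a - b by rewrite subr_gt0.
rewrite -(pmulr_rle0 _ ab0).
have -> : (a - b) * quot a b e q1 q2 x z = rhs a e q1 q2 - rhs b e q1 q2
    - ((a ^+ 6 - b ^+ 6) + e * (a ^+ 4 - b ^+ 4)) * x - (a ^+ 4 - b ^+ 4) * z.
  have -> : rhs a e q1 q2 - rhs b e q1 q2 = q1 ^+ 2 * (a ^+ 3 - b ^+ 3)
      + 2 * (e * q1 ^+ 2 + q2 ^+ 2) * (a - b) - (a ^+ 7 - b ^+ 7).
    by rewrite /rhs; ring.
  by rewrite !dpowE /quot; ring.
rewrite -Ea -Eb.
have x1x : x1 <= x by have := H 1 0; rewrite expr1n expr0n /=; lra.
have z1z : z1 <= z by have := H 0 1; rewrite expr1n expr0n /=; lra.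
have Hw : q2 ^+ 2 * x1 - 2 * q1 * q2 * y1 + q1 ^+ 2 * z1 <=
    q2 ^+ 2 * x - 2 * q1 * q2 * y + q1 ^+ 2 * z.
  by have := H q2 (- q1); rewrite sqrrN; lra.
have k1 : (a ^+ 6 + e * a ^+ 4) * x1 <= (a ^+ 6 + e * a ^+ 4) * x.
  by apply: ler_wpM2l => //; rewrite addr_ge0 ?mulr_ge0 ?exprn_ge0// ltW.
have k2 : a ^+ 4 * z1 <= a ^+ 4 * z.
  by apply: ler_wpM2l => //; rewrite exprn_ge0// ltW.
move: k1 k2 Hw; lra.
Qed.

(** In [quot] on the diagonal, |Du|^2 has a coefficient at least [Num.min (c1 ^+ 2) 1]. The
    numerator dominates what is subtracted: [7 * c2 ^+ 6] comes from [dpow 7], and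
    [c2 ^+ 3 + 2 * c2] bounds the eigenvalue [k] of [quot_gt0], hence also [x] and [z]. *)
Definition quot_bound c1 c2 : R :=
  (7 * c2 ^+ 6 + (6 * c2 ^+ 5 + 8 * c2 ^+ 3) * (c2 ^+ 3 + 2 * c2)) /
  Num.min (c1 ^+ 2) 1.

Lemma quot_bound_ge0 c1 c2 : 0 <= c2 -> 0 <= quot_bound c1 c2.
Proof.
move=> c20; have c2n n : 0 <= c2 ^+ n by exact: exprn_ge0.
rewrite divr_ge0//; last by rewrite le_min sqr_ge0 ler01.
by rewrite !(c2n, c20, ler0n, addr_ge0, mulr_ge0).
Qed.

(* At an interior maximum of |Du| the Hessian of u is k n (x) n, with n a unit
   normal to Du, and the equation bounds k from above independently of |Du|. *)
Lemma quot_gt0 c1 c2 g e q1 q2 x y z : 0 < c1 -> c1 <= g <= c2 ->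
  0 <= e <= 1 -> eqn g e q1 q2 x y z ->
  q1 * x + q2 * y = 0 -> q1 * y + q2 * z = 0 ->
  quot_bound c1 c2 < q1 ^+ 2 + q2 ^+ 2 ->
  0 < quot g g e q1 q2 x z.
Proof.
move=> c10 /andP[c1g gc2] /andP[e0 e1] E K1 K2.
have g0 : 0 < g by exact: lt_le_trans c1g.
have c20 : 0 < c2 by exact: lt_le_trans gc2.
have mu0 : 0 < Num.min (c1 ^+ 2) 1 by rewrite lt_min exprn_gt0//= ltr01.
rewrite /quot_bound ltr_pdivrMr//.
set mu := Num.min _ _ in mu0 *; set N := q1 ^+ 2 + q2 ^+ 2 => HN.
have mule : mu <= c1 ^+ 2 /\ mu <= 1 by apply/andP; rewrite -le_min.
have num0 : 0 < 7 * c2 ^+ 6 + (6 * c2 ^+ 5 + 8 * c2 ^+ 3) * (c2 ^+ 3 + 2 * c2).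
  by rewrite addr_gt0 ?mulr_gt0 ?addr_gt0 ?mulr_gt0 ?exprn_gt0.
have N0 : 0 < N by rewrite -(pmulr_lgt0 _ mu0); exact: lt_trans HN.
(* Since Du spans a kernel direction of the Hessian, its trace [k] is the remaining eigenvalue. *)
pose k := x + z.
have kx : N * x = k * q2 ^+ 2.
  apply/eqP; rewrite -subr_eq0.
  have -> : N * x - k * q2 ^+ 2 =
    q1 * (q1 * x + q2 * y) - q2 * (q1 * y + q2 * z) by rewrite /N /k; ring.
  by rewrite K1 K2 !mulr0 subrr.
have kz : N * z = k * q1 ^+ 2.
  by rewrite -[z](addKr x) mulrDr mulrN kx -/k /N; ring.
have Hk : q2 ^+ 2 * x - 2 * q1 * q2 * y + q1 ^+ 2 * z = N * k.
  apply/eqP; rewrite -subr_eq0.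
  have -> : q2 ^+ 2 * x - 2 * q1 * q2 * y + q1 ^+ 2 * z - N * k =
    - q1 * (q1 * x + q2 * y) - q2 * (q1 * y + q2 * z) by rewrite /N /k; ring.
  by rewrite K1 K2 !mulr0 subrr.
pose c := (g ^+ 6 + e * g ^+ 4) * q2 ^+ 2 + g ^+ 4 * q1 ^+ 2.
have gn n : 0 <= g ^+ n by rewrite exprn_ge0// ltW.
have c0 : 0 <= c.
  apply: addr_ge0; apply: mulr_ge0; rewrite ?sqr_ge0 ?gn//.
  by apply: addr_ge0; [exact: gn|apply: mulr_ge0].
(* This is the equation multiplied by [N], with [N * x], [N * z] and the rank-one term expressed
   through [k]. *)
have kE : k * (c + N ^+ 2) = N * rhs g e q1 q2.
  rewrite -E Hk !mulrDr.
  have -> : N * ((g ^+ 6 + e * g ^+ 4) * x) = (g ^+ 6 + e * g ^+ 4) * (N * x).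
    by ring.
  have -> : N * (g ^+ 4 * z) = g ^+ 4 * (N * z) by ring.
  by rewrite kx kz /c /N; ring.
pose B := g ^+ 3 + 2 * g.
have B0 : 0 <= B by rewrite addr_ge0 ?mulr_ge0 ?gn// ltW.
have rB : rhs g e q1 q2 <= B * N.
  rewrite -subr_ge0.
  have -> : B * N - rhs g e q1 q2 =
    g ^+ 3 * q2 ^+ 2 + 2 * g * ((1 - e) * q1 ^+ 2) + g ^+ 7.
    by rewrite /B /N /rhs; ring.
  by rewrite !(sqr_ge0, gn, subr_ge0, ltW g0, e1, ler0n, addr_ge0, mulr_ge0).
have kB : k <= B.
  have [k0|k0] := lerP k 0; first exact: le_trans k0 B0.
  have N20 : 0 < N ^+ 2 by rewrite exprn_gt0.
  rewrite -(ler_pM2r N20); apply: (@le_trans _ _ (k * (c + N ^+ 2))).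
    by rewrite ler_pM2l// ler_wpDl.
  by rewrite kE expr2 mulrA mulrC ler_pM2r.
have xB : x <= B.
  rewrite -(ler_pM2l N0) kx; apply: (@le_trans _ _ (B * q2 ^+ 2)).
    by rewrite ler_wpM2r ?sqr_ge0.
  by rewrite mulrC ler_wpM2r// /N ler_wpDl ?sqr_ge0.
have zB : z <= B.
  rewrite -(ler_pM2l N0) kz; apply: (@le_trans _ _ (B * q1 ^+ 2)).
    by rewrite ler_wpM2r ?sqr_ge0.
  by rewrite mulrC ler_wpM2r// /N ler_wpDr ?sqr_ge0.
have gc n : g ^+ n <= c2 ^+ n.
  by apply: lerXn2r; rewrite ?nnegrE ?(ltW g0) ?(ltW c20).
have BB : B <= c2 ^+ 3 + 2 * c2 by rewrite lerD ?gc// ler_pM2l.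
have f1 : (6 * g ^+ 5 + 4 * e * g ^+ 3) * x <=
    (6 * c2 ^+ 5 + 4 * c2 ^+ 3) * (c2 ^+ 3 + 2 * c2).
  apply: (@le_trans _ _ ((6 * g ^+ 5 + 4 * e * g ^+ 3) * B)).
    by apply: ler_wpM2l => //; rewrite !(gn, e0, ler0n, addr_ge0, mulr_ge0).
  apply: ler_pM => //; first by rewrite !(gn, e0, ler0n, addr_ge0, mulr_ge0).
  apply: lerD; first by rewrite ler_wpM2l.
  by apply: ler_pM => //; rewrite ?mulr_ge0//; apply: ler_piMr.
have f2 : 4 * g ^+ 3 * z <= 4 * c2 ^+ 3 * (c2 ^+ 3 + 2 * c2).
  apply: (@le_trans _ _ (4 * g ^+ 3 * B)).
    by apply: ler_wpM2l => //; rewrite mulr_ge0.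
  apply: ler_pM => //; first by rewrite !(gn, ler0n, mulr_ge0).
  by rewrite ler_pM2l ?ltr0n.
have f3 : mu * q1 ^+ 2 <= g ^+ 2 * q1 ^+ 2.
  apply: ler_wpM2r; first exact: sqr_ge0.
  apply: le_trans mule.1 _.
  by apply: lerXn2r; rewrite ?nnegrE ?(ltW g0) ?(ltW c10).
have f4 : mu * q2 ^+ 2 <= q2 ^+ 2.
  by rewrite ler_piMl ?sqr_ge0 ?mule.2.
have f5 := gc 6.
have f6 : 0 <= e * q1 ^+ 2 by rewrite mulr_ge0 ?sqr_ge0.
have f7 : 0 <= g ^+ 2 * q1 ^+ 2 by rewrite mulr_ge0 ?sqr_ge0.
have f8 : 0 <= q2 ^+ 2 by exact: sqr_ge0.
have -> : quot g g e q1 q2 x z = 3 * (g ^+ 2 * q1 ^+ 2) + 2 * (e * q1 ^+ 2)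
  + 2 * q2 ^+ 2 - 7 * g ^+ 6 - (6 * g ^+ 5 + 4 * e * g ^+ 3) * x - 4 * g ^+ 3 * z.
  by rewrite /quot !dpow_diag /=; ring.
have {}HN : 7 * c2 ^+ 6 + (6 * c2 ^+ 5 + 8 * c2 ^+ 3) * (c2 ^+ 3 + 2 * c2) <
   mu * q1 ^+ 2 + mu * q2 ^+ 2 by rewrite -mulrDr [ltRHS]mulrC.
move: HN f1 f2 f3 f4 f5 f6 f7 f8; lra.
Qed.

End Algebra.

(** * The substitution u = g^3/3: regularity, derivatives and the transformed equation *)

Section Cube.
Variable R : realType.
Implicit Types (Omega : set (R * R)) (f g h u : R * R -> R) (p q v w : R * R).

Lemma C1_in_eq Omega f h : open Omega -> (forall q, Omega q -> f q = h q) ->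
  C1_in Omega f -> C1_in Omega h.
Proof.
move=> oO fh f1 p Op; have [dx dt c cx ct] := f1 p Op.
have OO : \forall q \near p, Omega q by exact: open_nbhs_nbhs.
have fhn q : Omega q -> \forall q' \near q, f q' = h q'.
  by move=> Oq; apply: filterS fh _; exact: open_nbhs_nbhs.
split.
- exact: near_eq_derivable (fhn p Op) dx.
- exact: near_eq_derivable (fhn p Op) dt.
- exact: near_eq_continuous (fhn p Op) c.
- apply: near_eq_continuous _ cx; apply: filterS OO => q Oq.
  exact: near_eq_derive (fhn q Oq).
- apply: near_eq_continuous _ ct; apply: filterS OO => q Oq.
  exact: near_eq_derive (fhn q Oq).
Qed.

Lemma C1_in_cst Omega (c : R) : C1_in Omega (cst c).
Proof.
have D0 w : 'D_w (cst c : R * R -> R) = cst 0.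
  by apply/funext => q; exact: derive_cst.
move=> p _; split; rewrite /Dx /Dt ?D0;
  do [exact: derivable_cst | exact: cst_continuous].
Qed.

Lemma derive_mul_in Omega f h q w : open Omega -> C1_in Omega f ->
  C1_in Omega h -> Omega q ->
  is_derive q w (f * h) (f q * 'D_w h q + h q * 'D_w f q).
Proof.
move=> oO f1 h1 Oq.
have [df _] := C1_is_derive w oO f1 Oq; have [dh _] := C1_is_derive w oO h1 Oq.
exact: is_deriveM (derivableP df) (derivableP dh).
Qed.

Lemma C1_in_mul Omega f h : open Omega -> C1_in Omega f -> C1_in Omega h ->
  C1_in Omega (f * h).
Proof.
move=> oO f1 h1 p Op.
have [_ _ cf _ _] := f1 p Op; have [_ _ ch _ _] := h1 p Op.
have OO : \forall q \near p, Omega q by exact: open_nbhs_nbhs.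
have cD w : {for p, continuous ('D_w (f * h))}.
  apply: (@near_eq_continuous _ _ (fun q => f q * 'D_w h q + h q * 'D_w f q)).
    apply: filterS OO => q Oq.
    by have [_ ->] := derive_mul_in w oO f1 h1 Oq.
  have cDf : {for p, continuous ('D_w f)} by exact: C1_derive_continuous Op.
  have cDh : {for p, continuous ('D_w h)} by exact: C1_derive_continuous Op.
  by apply: cvgD; apply: cvgM; assumption.
split; [| | |exact: cD|exact: cD].
- by have [] := derive_mul_in (1, 0) oO f1 h1 Op.
- by have [] := derive_mul_in (0, 1) oO f1 h1 Op.
- by apply: cvgM; assumption.
Qed.

Definition cube g p : R := g p ^+ 3 / 3.

Lemma cubeE g : cube g = g * (g * g) * cst 3^-1.
Proof. by apply/funext => p; rewrite /cube 2!exprS expr1. Qed.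

Lemma derive_sqr_mul Omega g h q w : open Omega -> C1_in Omega g ->
  C1_in Omega h -> Omega q ->
  'D_w (g * g * h) q = g q ^+ 2 * 'D_w h q + 2 * g q * 'D_w g q * h q.
Proof.
move=> oO g1 h1 Oq.
have [_ ->] := derive_mul_in w oO (C1_in_mul oO g1 g1) h1 Oq.
have [_ ->] := derive_mul_in w oO g1 g1 Oq; rewrite !fctE.
move: ('D_w g q) ('D_w h q) (g q) (h q) => a b c d.
ring.
Qed.

Lemma cube_derive Omega g q w : open Omega -> C1_in Omega g -> Omega q ->
  'D_w (cube g) q = g q ^+ 2 * 'D_w g q.
Proof.
move=> oO g1 Oq; rewrite cubeE.
have [_ ->] := derive_mul_in w oO
  (C1_in_mul oO g1 (C1_in_mul oO g1 g1)) (@C1_in_cst Omega 3^-1) Oq.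
have [_ ->] := derive_mul_in w oO g1 (C1_in_mul oO g1 g1) Oq.
have [_ ->] := derive_mul_in w oO g1 g1 Oq.
rewrite derive_cst !fctE.
move: ('D_w g q) (g q) => a b.
by field.
Qed.

Lemma cube_derive2 Omega g q v w : open Omega -> C1_in Omega g ->
  C1_in Omega ('D_v g) -> Omega q ->
  'D_w ('D_v (cube g)) q =
    g q ^+ 2 * 'D_w ('D_v g) q + 2 * g q * 'D_w g q * 'D_v g q.
Proof.
move=> oO g1 gv1 Oq; rewrite -(derive_sqr_mul _ oO g1 gv1 Oq).
apply: near_eq_derive.
have OO : \forall q' \near q, Omega q' by exact: open_nbhs_nbhs.
apply: filterS OO => q' Oq'; rewrite (cube_derive _ oO g1 Oq').
by rewrite !fctE expr2.
Qed.

Lemma cube_C2 Omega g : open Omega -> C2_in Omega g -> C2_in Omega (cube g).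
Proof.
move=> oO [g1 gx gt].
have c1 : C1_in Omega (cube g).
  rewrite cubeE.
  exact: (C1_in_mul oO (C1_in_mul oO g1 (C1_in_mul oO g1 g1)) (@C1_in_cst _ _)).
have gg := C1_in_mul oO g1 g1.
split; first exact: c1.
- apply: C1_in_eq (C1_in_mul oO gg gx) => // q Oq.
  by rewrite [RHS](cube_derive _ oO g1 Oq) !fctE expr2.
- apply: C1_in_eq (C1_in_mul oO gg gt) => // q Oq.
  by rewrite [RHS](cube_derive _ oO g1 Oq) !fctE expr2.
Qed.

Lemma cube_eqn Omega eps g p : open Omega -> C2_in Omega g -> Omega p ->
  eps_horizontal_minimal eps Omega g ->
  let u := cube g in
  eqn (g p) eps (Dx u p) (Dt u p) (Dx (Dx u) p) (Dt (Dx u) p) (Dt (Dt u) p).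
Proof.
move=> oO [g1 gx gt] Op /(_ p Op) E u.
rewrite /eqn /rhs /u.
have -> : Dx (cube g) p = g p ^+ 2 * Dx g p by exact: cube_derive Op.
have -> : Dt (cube g) p = g p ^+ 2 * Dt g p by exact: cube_derive Op.
have -> : Dx (Dx (cube g)) p =
    g p ^+ 2 * Dx (Dx g) p + 2 * g p * Dx g p * Dx g p.
  exact: (@cube_derive2 Omega g p (1, 0) (1, 0) oO g1 gx Op).
have -> : Dt (Dx (cube g)) p =
    g p ^+ 2 * Dt (Dx g) p + 2 * g p * Dt g p * Dx g p.
  exact: (@cube_derive2 Omega g p (1, 0) (0, 1) oO g1 gx Op).
have -> : Dt (Dt (cube g)) p =
    g p ^+ 2 * Dt (Dt g) p + 2 * g p * Dt g p * Dt g p.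
  exact: (@cube_derive2 Omega g p (0, 1) (0, 1) oO g1 gt Op).
move: E; move: (Dx (Dx g) p) (Dt (Dx g) p) (Dt (Dt g) p) (Dx g p) (Dt g p) (g p).
move=> x y z q1 q2 c E; apply/eqP; rewrite -subr_eq0; apply/eqP.
(* The two sides of [eqn] differ by g^6 times the left-hand side of the equation for [g]. *)
rewrite -[RHS](mulr0 (c ^+ 6)) -E; ring.
Qed.

End Cube.

(** * Critical points, short segments, and continuity of [quot] *)

Section InteriorMax.
Variable R : realType.
Implicit Types (Omega : set (R * R)) (f g h u : R * R -> R) (p q v w : R * R).

Lemma C1_in_add Omega f h : open Omega -> C1_in Omega f -> C1_in Omega h ->
  C1_in Omega (f + h).
Proof.
move=> oO f1 h1 p Op.
have [fx ft cf _ _] := f1 p Op; have [hx ht ch _ _] := h1 p Op.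
have OO : \forall q \near p, Omega q by exact: open_nbhs_nbhs.
have cD w : {for p, continuous ('D_w (f + h))}.
  apply: (@near_eq_continuous _ _ (fun q => 'D_w f q + 'D_w h q)).
    apply: filterS OO => q Oq.
    have [df _] := C1_is_derive w oO f1 Oq.
    have [dh _] := C1_is_derive w oO h1 Oq.
    exact: esym (deriveD df dh).
  have cDf : {for p, continuous ('D_w f)} by exact: C1_derive_continuous Op.
  have cDh : {for p, continuous ('D_w h)} by exact: C1_derive_continuous Op.
  by apply: cvgD; assumption.
split; [exact: derivableD|exact: derivableD| |exact: cD|exact: cD].
by apply: cvgD; assumption.
Qed.

Lemma C1_max_derive0 Omega f p w : open Omega -> C1_in Omega f -> Omega p ->
  (\forall q \near p, f q <= f p) -> 'D_w f p = 0.
Proof.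
move=> oO f1 Op fmax.
have OO : \forall q \near p, Omega q by exact: open_nbhs_nbhs.
have le0 v : 'D_v f p <= 0.
  apply: derive_max_le0 => //; last exact: C1_derive_continuous Op.
  by apply: filterS OO => q Oq; have [] := C1_is_derive v oO f1 Oq.
apply/eqP; rewrite eq_le le0 /=.
have := le0 (- w).
have [_ ->] := C1_is_derive (- w) oO f1 Op.
have [_ ->] := C1_is_derive w oO f1 Op.
by rewrite /= !mulNr -opprD oppr_le0.
Qed.

(** The mean value theorem needs [Q] along the whole segment from [z.1] to [z.1 + z.2 *: e],
    uniformly in [z]. Using [|e| + 1] in the radius covers [e = 0]. *)
Lemma near_segment (V : normedModType R) (p e : V) (Q : set V) :
  nbhs p Q -> \forall z \near (p, 0 : R),
    forall s : R, 0 <= s <= 1 -> Q (z.1 + (s * z.2) *: e).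
Proof.
move=> /nbhs_ballP[r /= r0 rQ].
have k0 : 0 < `|e| + 1 by rewrite ltr_wpDl.
exists (ball p (r / 2), ball (0 : R) (r / 2 / (`|e| + 1))).
  by split; apply: nbhsx_ballx; rewrite ?divr_gt0.
move=> [q d] /= [qp d0] s /andP[s0 s1]; apply: rQ.
move: qp d0; rewrite -!ball_normE /= sub0r normrN => qp.
rewrite ltr_pdivlMr// => d0.
rewrite opprD addrA [r]splitr; apply: le_lt_trans (ler_normB _ _) _.
apply: ltrD; [exact: qp|rewrite normrZ normrM (ger0_norm s0)].
apply: le_lt_trans d0; rewrite ler_pM ?mulr_ge0//; first by rewrite ler_piMl.
by rewrite lerDl.
Qed.

Lemma cvg_pow (T : Type) (F : set_system T) (FF : Filter F) (f : T -> R)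
    (a : R) n : f @ F --> a -> (fun z => f z ^+ n) @ F --> a ^+ n.
Proof.
move=> fa; elim: n => [|n IH].
  by rewrite expr0; under eq_fun do rewrite expr0; exact: cvg_cst.
by rewrite exprS; under eq_fun do rewrite exprS; exact: cvgM.
Qed.

Lemma cvg_dpow (T : Type) (F : set_system T) (FF : Filter F) (f h : T -> R)
    (a b : R) n : f @ F --> a -> h @ F --> b ->
  (fun z => dpow n (f z) (h z)) @ F --> dpow n a b.
Proof.
move=> fa hb; apply: cvg_big => [|i _]; first exact: add_continuous.
by apply: cvgM; exact: cvg_pow.
Qed.

Lemma cvg_quot (T : Type) (F : set_system T) (FF : Filter F)
    (f h q1 q2 x z : T -> R) (a b e c1 c2 l m : R) :
  f @ F --> a -> h @ F --> b -> q1 @ F --> c1 -> q2 @ F --> c2 ->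
  x @ F --> l -> z @ F --> m ->
  (fun t => quot (f t) (h t) e (q1 t) (q2 t) (x t) (z t)) @ F -->
    quot a b e c1 c2 l m.
Proof.
move=> fa hb q1c q2c xl zm.
have D n : (fun t => dpow n (f t) (h t)) @ F --> dpow n a b by exact: cvg_dpow.
have P1 : (fun t => q1 t ^+ 2) @ F --> c1 ^+ 2 by exact: cvg_pow.
have P2 : (fun t => q2 t ^+ 2) @ F --> c2 ^+ 2 by exact: cvg_pow.
apply: cvgB; last by apply: cvgM => //; exact: D.
apply: cvgB.
  apply: cvgB; last exact: D.
  apply: cvgD; first by apply: cvgM => //; exact: D.
  apply: cvgM; first exact: cvg_cst.
  by apply: cvgD => //; apply: cvgM => //; exact: cvg_cst.
apply: cvgM => //; apply: cvgD; first exact: D.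
by apply: cvgM; [exact: cvg_cst|exact: D].
Qed.

End InteriorMax.

(** * Exclusion of a large interior maximum of |Du| *)

Section NoLargeInteriorMax.
Variables (R : realType) (Omega : set (R * R)) (eps c1 c2 : R).
Variables (g : R * R -> R) (p0 : R * R) (L : R) (K : set (R * R)).
Hypotheses (oO : open Omega) (g2 : C2_in Omega g) (c10 : 0 < c1).
Hypotheses (eps01 : 0 <= eps <= 1) (gE : eps_horizontal_minimal eps Omega g).
Hypothesis gc : forall p, Omega p -> c1 <= g p <= c2.

Implicit Types p q w : R * R.

Let u := cube g.
Let e : R * R := (Dx u p0, Dt u p0).
Let N := e.1 ^+ 2 + e.2 ^+ 2.
Let f p := e.1 * Dx u p + e.2 * Dt u p.

Hypotheses (Op0 : Omega p0) (KO : K `<=` Omega) (compactK : compact K).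
Hypothesis duN : forall p, Omega p -> Dx u p ^+ 2 + Dt u p ^+ 2 <= N.
Hypothesis Nlarge : quot_bound c1 c2 < N.
Hypothesis LN : L < N.
(** Points of [Omega] with [f > L] are thus interior to [K], so that a maximum over [K] attained
    there is a local maximum. *)
Hypothesis LK : forall p, Omega p -> L <= f p -> K p.

Let u2 : C2_in Omega u. Proof. exact: cube_C2. Qed.
Let u1 : C1_in Omega u. Proof. by case: u2. Qed.
Let ux1 : C1_in Omega (Dx u). Proof. by case: u2. Qed.
Let ut1 : C1_in Omega (Dt u). Proof. by case: u2. Qed.

Let fp0 : f p0 = N. Proof. by rewrite /f /N /= !expr2. Qed.

(** Expanding |Du - e|^2 >= 0 gives 2 f <= |Du|^2 + N <= 2 N. *)
Let fN p : Omega p -> f p <= N.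
Proof.
move=> Op; have := duN Op; have := sqr_ge0 (Dx u p - e.1).
have := sqr_ge0 (Dt u p - e.2); rewrite /f /N.
move: (Dx u p) (Dt u p) e.1 e.2 => a b c d; nra.
Qed.

Let fE p : Omega p -> 'D_e u p = f p.
Proof. by move=> Op; have [_ ->] := C1_is_derive e oO u1 Op. Qed.

Let f1 : C1_in Omega f.
Proof.
exact: (C1_in_add oO (C1_in_mul oO (@C1_in_cst _ _ e.1) ux1)
  (C1_in_mul oO (@C1_in_cst _ _ e.2) ut1)).
Qed.

(** Equality case of [fN]: here |Du - e|^2 = |Du|^2 - N <= 0. *)
Let du_eq p : Omega p -> f p = N -> Dx u p = e.1 /\ Dt u p = e.2.
Proof.
move=> Op fp; have := duN Op; rewrite -subr_le0 => H.
have Z : (Dx u p - e.1) ^+ 2 + (Dt u p - e.2) ^+ 2 <= 0.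
  apply: le_trans H; rewrite -fp /f -subr_ge0; move: fp; rewrite /f /N.
  by move: (Dx u p) (Dt u p) e.1 e.2 => a b c d; lra.
have Z1 := sqr_ge0 (Dx u p - e.1); have Z2 := sqr_ge0 (Dt u p - e.2).
split; apply/eqP; rewrite -subr_eq0 -sqrf_eq0 eq_le.
- rewrite Z1 andbT; apply: le_trans Z; rewrite lerDl; exact: Z2.
- rewrite Z2 andbT; apply: le_trans Z; rewrite lerDr; exact: Z1.
Qed.

(** By [fN] the function [f] is maximal at [p], so its gradient D^2 u e vanishes there. *)
Let ker p : Omega p -> f p = N ->
  e.1 * Dx (Dx u) p + e.2 * Dt (Dx u) p = 0 /\
  e.1 * Dt (Dx u) p + e.2 * Dt (Dt u) p = 0.
Proof.
move=> Op fp.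
have fmax : \forall q \near p, f q <= f p.
  have OO : \forall q \near p, Omega q by exact: open_nbhs_nbhs.
  by apply: filterS OO => q Oq; rewrite fp; exact: fN.
have Df w : 'D_w f p = e.1 * 'D_w (Dx u) p + e.2 * 'D_w (Dt u) p.
  have [dx _] := C1_is_derive w oO ux1 Op.
  have [dt _] := C1_is_derive w oO ut1 Op.
  have -> : f = (e.1 \*: Dx u) + (e.2 \*: Dt u) by [].
  rewrite (deriveD (derivableZ dx) (derivableZ dt)).
  by rewrite (deriveZ _ dx) (deriveZ _ dt).
split.
- by rewrite (C2_symmetric oO u2 Op) -(C1_max_derive0 (1, 0) oO f1 Op fmax) Df.
- by rewrite -(C1_max_derive0 (0, 1) oO f1 Op fmax) Df.
Qed.

(** The premise [0 < d] sits inside so that the property can hold on a full neighbourhood of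
    [(p, 0)], as the compactness argument requires. The first conjunct serves to make the increment
    of [u] continuous on [K]. *)
Let nonmax (d : R) p : Prop :=
  Omega (p + d *: e) /\
  (0 < d -> ~ (forall q, K q -> u (q + d *: e) - u q <= u (p + d *: e) - u p)).

Let MVT_e q (d : R) : (forall s : R, 0 <= s <= 1 -> Omega (q + (s * d) *: e)) ->
  exists2 s : R, 0 <= s <= 1 &
    u (q + d *: e) - u q = d * f (q + (s * d) *: e).
Proof.
move=> Oq; have [s s01|s /andP[s0 s1] E] := @MVT_line R _ u q e d.
  by have [] := C1_is_derive e oO u1 (Oq s s01).
have s01 : 0 <= s <= 1 by rewrite !ltW.
by exists s => //; rewrite E (fE (Oq s s01)).
Qed.

Let fstp p : z.1 @[z --> (p, 0 : R)] --> p.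
Proof. exact: (@cvg_fst _ _ (nbhs p) (nbhs (0 : R))). Qed.

Let sndp p : z.2 @[z --> (p, 0 : R)] --> (0 : R).
Proof. exact: (@cvg_snd _ _ (nbhs p) (nbhs (0 : R))). Qed.

Let FF p : Filter (nbhs (p, 0 : R)).
Proof. exact: nbhs_filter. Qed.

(** Such points lose against [p0]. With [c] strictly between [f p] and [N], the increment of [u]
    over [d *: e] is below [d * c] near [p], while at [p0] it exceeds [d * c] for small [d], the
    derivative there being [N]. *)
Let nonmax_low p : Omega p -> f p < N ->
  \forall z \near (p, 0 : R), nonmax z.2 z.1.
Proof.
move=> Op fpN; pose c := (f p + N) / 2.
have fpc : f p < c by rewrite /c; lra.
have cN : c < N by rewrite /c; lra.
have OO : \forall q \near p, Omega q by exact: open_nbhs_nbhs.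
have fc : \forall q \near p, f q < c.
  by have [_ _ cf _ _] := f1 Op; exact: (cvgr_lt _ cf).
have seg : \forall z \near (p, 0 : R), forall s : R, 0 <= s <= 1 ->
    Omega (z.1 + (s * z.2) *: e) /\ f (z.1 + (s * z.2) *: e) < c.
  exact: near_segment (filterI OO fc).
have d0 : \forall d \near (0 : R), 0 < d -> d * c < u (p0 + d *: e) - u p0.
  have [dp0 E] := C1_is_derive e oO u1 Op0.
  have /= : \forall h \near 0^', c < h^-1 *: (u (h *: e + p0) - u p0).
    by apply: (cvgr_gt _ dp0); rewrite -/('D_e u p0) fE// fp0.
  rewrite near_withinE; apply: filterS => h hP h0; rewrite [p0 + _]addrC.
  have := hP (lt0r_neq0 h0); rewrite /GRing.scale /= mulrC.
  by rewrite ltr_pdivlMr// mulrC.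
have d0' : \forall z \near (p, 0 : R), 0 < z.2 ->
    z.2 * c < u (p0 + z.2 *: e) - u p0.
  exact: (@sndp p _ d0).
apply: (@filterS2 _ _ (FF p) _ _ _ _ seg d0') => -[q d] /= {}seg d0''; split.
  have [|//] := seg 1; first by rewrite ler01 lexx.
  by rewrite mul1r.
move=> dgt0 /(_ p0); have Kp0 : K p0 by apply: LK => //; rewrite fp0 ltW.
move=> /(_ Kp0); apply/negP; rewrite -ltNge; apply: lt_trans (d0'' dgt0).
have [s s01|s s01 ->] := @MVT_e q d; first by case: (seg s s01).
by rewrite ltr_pM2l//; case: (seg s s01).
Qed.

(** At [p] the limiting quotient is positive by [quot_gt0], and by continuity it stays positive for
    nearby pairs; a maximum over [K] at such a pair would contradict [quot_le0]. *)
Let nonmax_top p : Omega p -> f p = N ->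
  \forall z \near (p, 0 : R), nonmax z.2 z.1.
Proof.
move=> Op fpN.
have [uxp utp] := du_eq Op fpN.
have [k1 k2] := ker Op fpN.
have qpos : 0 < quot (g p) (g p) eps (Dx u p) (Dt u p)
    (Dx (Dx u) p) (Dt (Dt u) p).
  apply: (quot_gt0 c10 (gc Op) eps01 (cube_eqn oO g2 Op gE)); rewrite -/u uxp utp//.
have OO : \forall q \near p, Omega q by exact: open_nbhs_nbhs.
have quot_bound0 : 0 <= quot_bound c1 c2.
  apply: quot_bound_ge0; have /andP[c1g gc2] := gc Op0.
  exact: le_trans (ltW c10) (le_trans c1g gc2).
have N0 : 0 < N by exact: le_lt_trans Nlarge.
have [_ _ cf _ _] := f1 Op.
have f0 : \forall q \near p, 0 < f q by apply: (cvgr_gt _ cf); rewrite fpN.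
have fL : \forall q \near p, L < f q by apply: (cvgr_gt _ cf); rewrite fpN.
have seg : \forall z \near (p, 0 : R), forall s : R, 0 <= s <= 1 ->
    Omega (z.1 + (s * z.2) *: e) /\ 0 < f (z.1 + (s * z.2) *: e).
  exact: near_segment (filterI OO f0).
have [g1 _ _] := g2.
have shp : (fun z : (R * R) * R => z.1 + z.2 *: e) @ (p, 0 : R) --> p.
  rewrite -[X in _ --> X]addr0 -(scale0r e); apply: cvgD; first exact: fstp.
  by apply: cvgZ; [exact: sndp|exact: cvg_cst].
have cq : quot (g (z.1 + z.2 *: e)) (g z.1) eps (Dx u z.1) (Dt u z.1)
      (Dx (Dx u) z.1) (Dt (Dt u) z.1) @[z --> (p, 0 : R)] -->
    quot (g p) (g p) eps (Dx u p) (Dt u p) (Dx (Dx u) p) (Dt (Dt u) p).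
  have [_ _ cg _ _] := g1 p Op; have [_ _ cx cxx _] := ux1 Op.
  have [_ _ ct _ ctt] := ut1 Op.
  apply: (cvg_quot (FF p)).
  - exact: (@cvg_comp _ _ _ _ g _ _ _ shp cg).
  - exact: (@cvg_comp _ _ _ _ g _ _ _ (@fstp p) cg).
  - exact: (@cvg_comp _ _ _ _ (Dx u) _ _ _ (@fstp p) cx).
  - exact: (@cvg_comp _ _ _ _ (Dt u) _ _ _ (@fstp p) ct).
  - exact: (@cvg_comp _ _ _ _ (Dx (Dx u)) _ _ _ (@fstp p) cxx).
  - exact: (@cvg_comp _ _ _ _ (Dt (Dt u)) _ _ _ (@fstp p) ctt).
have qnear : \forall z \near (p, 0 : R), 0 < quot (g (z.1 + z.2 *: e)) (g z.1) eps
    (Dx u z.1) (Dt u z.1) (Dx (Dx u) z.1) (Dt (Dt u) z.1).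
  exact: (cvgr_gt _ cq).
have fL' : \forall z \near (p, 0 : R), L < f z.1 by exact: (@fstp p _ fL).
apply: (@filterS3 _ _ (FF p) _ _ _ _ _ seg fL' qnear) => -[q d] /= {}seg Lfq qq.
have i0 : 0 <= (0 : R) <= 1 by rewrite lexx ler01.
have i1 : 0 <= (1 : R) <= 1 by rewrite lexx ler01.
have [Oqd _] := seg 1 i1; have [Oq _] := seg 0 i0.
rewrite mul1r in Oqd; rewrite mul0r scale0r addr0 in Oq.
split; first exact: Oqd.
move=> dgt0 qmax.
have [|E1 E2 E3] := @two_point_max R Omega u q (d *: e) oO u2 Oq Oqd.
  have OOq : \forall q' \near q, Omega q' by exact: open_nbhs_nbhs.
  have fLq : \forall q' \near q, L < f q'.
    by have [_ _ cfq _ _] := f1 Oq; exact: (cvgr_gt _ cfq).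
  apply: filterS2 OOq fLq => q' Oq' fLq'; apply: qmax; apply: LK => //.
  exact: ltW.
have gq0 : 0 < g q by have /andP[c1g _] := gc Oq; exact: lt_le_trans c1g.
have gqd0 : 0 < g (q + d *: e).
  by have /andP[c1g _] := gc Oqd; exact: lt_le_trans c1g.
(* Since [f > 0] along the segment, [u] strictly increases, and hence so does [g]; this fixes the
   sign when dividing by the difference of the two values. *)
have glt : g q < g (q + d *: e).
  rewrite ltNge; apply/negP => gle.
  have : u (q + d *: e) <= u q.
    rewrite /u /cube ler_pM2r ?invr_gt0 ?ltr0n//.
    by apply: lerXn2r; rewrite ?nnegrE ?(ltW gq0) ?(ltW gqd0).
  have [s s01|s s01 E] := @MVT_e q d; first by case: (seg s s01).
  rewrite -subr_le0 E leNgt mulr_gt0//.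
  by case: (seg s s01).
have Eqd := cube_eqn oO g2 Oqd gE; rewrite /= -/u E1 E2 in Eqd.
have Eq := cube_eqn oO g2 Oq gE.
have [eps0 _] := andP eps01.
move: qq; rewrite ltNge => /negP; apply.
by apply: quot_le0 gq0 glt eps0 Eqd Eq _ => w1 w2; exact: (E3 (w1, w2)).
Qed.

(** Each point of [K] satisfies [nonmax] locally and for small [d]; compactness in its near-covering
    form yields one [d > 0] valid on all of [K]. But a continuous increment does attain its maximum
    on [K]. *)
Lemma no_large_interior_max : False.
Proof.
have H : \forall d \near (0 : R), K `<=` nonmax d.
  have ncK := iffLR (compact_near_coveringP _) compactK.
  apply: (ncK R (nbhs (0 : R)) nonmax (nbhs_filter _)) => p Kp.
  have := fN (KO Kp); rewrite le_eqVlt => /predU1P[fpN|fpN].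
    exact: (nonmax_top (KO Kp) fpN).
  exact: (nonmax_low (KO Kp) fpN).
have [r /= r0 rH] := (iffLR (nbhs_ballP _ _)) H.
have d0 : 0 < r / 2 by rewrite divr_gt0.
have {rH} : K `<=` nonmax (r / 2).
  by apply: rH; rewrite /ball /= sub0r normrN gtr0_norm// ltr_pdivrMr ?ltr_pMr// ltr1n.
move: (r / 2) d0 => d d0 Knonmax.
have Kp0 : K p0 by apply: LK => //; rewrite fp0 ltW.
have cK : {within K, continuous (fun q => u (q + d *: e) - u q)}.
  apply: continuous_in_subspaceT => q; rewrite inE => Kq.
  have [_ _ cu _ _] := u1 (KO Kq).
  have [Oqd _] := Knonmax q Kq; have [_ _ cud _ _] := u1 Oqd.
  apply: cvgB; last exact: cu.
  apply: (@cvg_comp _ _ _ (fun q => q + d *: e) u _ _ _ _ cud).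
  by apply: cvgD; [exact: cvg_id|exact: cvg_cst].
have [q] := compact_EVT_max (ex_intro _ p0 Kp0) compactK cK.
rewrite inE => Kq qmax; have [_ /(_ d0)] := Knonmax q Kq; apply => q' Kq'.
by apply: qmax; rewrite inE.
Qed.

End NoLargeInteriorMax.

(** * Compactness of the domain, and the global gradient bound *)

Lemma bounded_closure_compact (R : realType) (A : set (R * R)) :
  bounded_set A -> compact (closure A).
Proof.
move=> [M [_ MA]].
have cS : compact (`[- (M + 1), M + 1] `*` `[- (M + 1), M + 1] : set (R * R)).
  by apply: compact_setX; exact: segment_compact.
have hS : hausdorff_space (R * R)%type by exact: norm_hausdorff.
apply: (subclosed_compact _ cS); first exact: closed_closure.
have -> : `[- (M + 1), M + 1] `*` `[- (M + 1), M + 1] =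
    closure (`[- (M + 1), M + 1] `*` `[- (M + 1), M + 1] : set (R * R)).
  by apply/closure_id; exact: compact_closed.
have M1 : M < M + 1 by rewrite ltrDl ltr01.
apply: closureS => p Ap; have : `|p| <= M + 1 by exact: MA Ap.
by rewrite prod_normE /= ge_max !in_itv /= !ler_norml => /andP[].
Qed.

Lemma compact_superlevel (T : topologicalType) (R : realType) (A : set T)
    (f : T -> R) (L : R) : compact A -> {within A, continuous f} ->
  compact [set p | A p /\ L <= f p].
Proof.
move=> cA cf.
have : closed ((f @^-1` [set x | L <= x]) : set (subspace A)).
  by apply: preimage_closed => [p _|]; [exact: cf|exact: closed_ge].
move=> /closed_subspaceP[V cV VA].
suff -> : [set p | A p /\ L <= f p] = A `&` V by exact: compact_closedI.
by rewrite setIC VA setIC.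
Qed.

Theorem theorem5p1 (R : realType) (c1 c2 c3 : R) :
  0 < c1 ->
  c2 < c1 + c1 * Num.sqrt (pi / 2) ->
  exists C : R,
    forall (Omega : set (R * R)) (eps alpha : R) (g : R * R -> R),
      bounded_C1_domain Omega ->
      0 <= eps <= 1 ->
      0 < alpha < 1 ->
      C2alpha_in alpha Omega g ->
      C1_closure Omega g ->
      (forall p, Omega p -> 0 < g p) ->
      eps_horizontal_minimal eps Omega g ->
      (forall p, closure Omega p -> c1 <= g p <= c2) ->
      (forall p, boundary Omega p -> enorm (grad Omega g p) <= c3) ->
      forall p, closure Omega p -> enorm (grad Omega g p) <= C.
Proof.
move=> c10 _.
(* [B] bounds |Du|^2 = g^4 |Dg|^2: the first entry handles an interior maximum, the second the
   boundary. Dividing by [c1 ^+ 4] then returns to |Dg|^2. *)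
pose B := Num.max (quot_bound c1 c2) (c2 ^+ 4 * c3 ^+ 2).
exists (Num.sqrt (B / c1 ^+ 4)) => Omega eps alpha g [oO _ _ bO _] eps01 _ [g2 _].
move=> [cg g1 [X [cX XE]] [Y [cY YE]]] _ gE gc gb p clp.
have gradE q : closure Omega q -> grad Omega g q = (X q, Y q).
  by move=> clq; rewrite /grad (closure_extE cX XE clq) (closure_extE cY YE clq).
have cK := bounded_closure_compact bO.
pose u := cube g.
have uX q : Omega q -> Dx u q = g q ^+ 2 * X q.
  by move=> Oq; rewrite XE ?inE//; exact: cube_derive Oq.
have uY q : Omega q -> Dt u q = g q ^+ 2 * Y q.
  by move=> Oq; rewrite YE ?inE//; exact: cube_derive Oq.
(* The continuous extension of |Du|^2 to the compact closure, where it attains its maximum. *)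
pose Q q := (g q ^+ 2 * X q) ^+ 2 + (g q ^+ 2 * Y q) ^+ 2.
have QE q : Q q = g q ^+ 4 * (X q ^+ 2 + Y q ^+ 2) by rewrite /Q; ring.
have cgX : {within closure Omega, continuous (fun q => g q ^+ 2 * X q)}.
  move=> q; apply: cvgM; last exact: cX.
  exact: cvg_pow (cg q).
have cgY : {within closure Omega, continuous (fun q => g q ^+ 2 * Y q)}.
  move=> q; apply: cvgM; last exact: cY.
  exact: cvg_pow (cg q).
have cQ : {within closure Omega, continuous Q}.
  by move=> q; apply: cvgD; apply: cvg_pow; [exact: cgX|exact: cgY].
have g0 q : closure Omega q -> 0 < g q.
  by move=> /gc /andP[+ _]; exact: lt_le_trans.
have Qbd q : boundary Omega q -> Q q <= B.
  move=> bq; have [clq _] := bq; have := gb q bq; rewrite gradE// /enorm /= => H.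
  rewrite QE; apply: (@le_trans _ _ (c2 ^+ 4 * c3 ^+ 2)); last first.
    by rewrite /B le_max lexx orbT.
  have s0 : 0 <= X q ^+ 2 + Y q ^+ 2 by rewrite addr_ge0 ?sqr_ge0.
  apply: ler_pM => //; first by rewrite exprn_ge0// ltW// g0.
    have /andP[_ gc2] := gc q clq; have gq := ltW (g0 q clq).
    by apply: lerXn2r; rewrite ?nnegrE// (le_trans gq).
  rewrite -[leLHS]sqr_sqrtr//; apply: lerXn2r => //; rewrite nnegrE ?sqrtr_ge0//.
  by apply: le_trans H; rewrite sqrtr_ge0.
suff QB : Q p <= B.
  rewrite gradE// /enorm /=; apply: ler_wsqrtr.
  rewrite ler_pdivlMr ?exprn_gt0// mulrC; apply: le_trans QB; rewrite QE.
  apply: ler_wpM2r; first by rewrite addr_ge0 ?sqr_ge0.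
  have /andP[gc1 _] := gc p clp.
  by apply: lerXn2r; rewrite ?nnegrE ?(ltW c10) ?(ltW (g0 p clp)).
have [p0] := compact_EVT_max (ex_intro _ p clp) cK cQ.
rewrite inE => clp0 Qmax; apply: (@le_trans _ _ (Q p0)); first by apply: Qmax; rewrite inE.
rewrite leNgt; apply/negP => BQ.
have Op0 : Omega p0.
  apply: contrapT => nOp0; move: BQ; apply/negP; rewrite -leNgt.
  by apply: Qbd; split => // /interior_subset.
pose e1 := Dx u p0; pose e2 := Dt u p0.
pose N := e1 ^+ 2 + e2 ^+ 2.
have NE : Q p0 = N by rewrite /N /e1 /e2 uX// uY.
pose F q := e1 * (g q ^+ 2 * X q) + e2 * (g q ^+ 2 * Y q).
(* A level strictly between (N + B)/2 and [N]. At a boundary point F <= (N + Q)/2 <= (N + B)/2 < L,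
   so the superlevel set of [F] at [L] is a compact set lying inside [Omega]; [aux] records this
   inequality. *)
pose L := (3 * N + B) / 4.
rewrite NE in BQ.
have LN : L < N by rewrite /L; lra.
have cF : {within closure Omega, continuous F}.
  by move=> q; apply: cvgD; (apply: cvgM; [exact: cvg_cst|]);
    [exact: cgX|exact: cgY].
have aux (a b c d : R) : (3 * (c ^+ 2 + d ^+ 2) + B) / 4 <= c * a + d * b ->
    B < c ^+ 2 + d ^+ 2 -> a ^+ 2 + b ^+ 2 <= B -> False.
  have := sqr_ge0 (a - c); have := sqr_ge0 (b - d); rewrite !sqrrB; lra.
apply: (@no_large_interior_max R Omega eps c1 c2 g p0 L
  [set q | closure Omega q /\ L <= F q] oO g2 c10 eps01 gE _ Op0) => //.
- by move=> q Oq; apply: gc; exact: subset_closure.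
- move=> q [clq LF]; apply: contrapT => nOq.
  have : Q q <= B by apply: Qbd; split => // /interior_subset.
  exact: aux LF BQ.
- exact: compact_superlevel.
- move=> q Oq; rewrite -/u (uX q Oq) (uY q Oq) -/(Q q) -/e1 -/e2 -/N -NE.
  by apply: Qmax; rewrite inE; exact: subset_closure.
- by apply: le_lt_trans BQ; rewrite le_max lexx.
- move=> q Oq; rewrite -/u /= (uX q Oq) (uY q Oq) => LF.
  by split; [exact: subset_closure|exact: LF].
Qed.
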